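(* For each integer $n\geq 1$ let $\gamma_{n}=1+\frac{1}{2}+\frac{1}{3}+\cdots+\frac{1}{n}-\ln n$. Then the limit $\gamma=\lim_{n\to\infty}\gamma_{n}$ (Euler's constant) exists, and $\gamma\in\left[\frac{1}{2},1\right)$. *)

(* Defs.v *)
(* Stdlib reals with Coquelicot. *)
From Stdlib Require Import Reals.
From Coquelicot Require Import Coquelicot.
Open Scope R_scope.

(* Meaningful for 1 <= n; at n = 0 the sum is empty and [ln 0] is a junk value,
   which has no influence on the limit of the sequence. *)
Definition euler_gamma_seq (n : nat) : R :=
  sum_n_m (fun k : nat => 1 / INR k) 1 n - ln (INR n).

(* Main.v *)
Require Import Defs.
From Stdlib Require Import Reals.
From Coquelicot Require Import Coquelicot.
From Stdlib Require Import Lra Lia.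
Open Scope R_scope.

(** The trapezoid bound [ln ((n + 1) / n) <= (1 / n + 1 / (n + 1)) / 2] makes
    [gamma_n - 1 / (2 n)] nondecreasing from its value [1 / 2] at [n = 1], and
    [1 / (n + 1) <= ln ((n + 1) / n)] makes [gamma_n] nonincreasing. Hence
    [gamma_n] converges, with limit at least [1 / 2] and at most
    [gamma_2 = 3 / 2 - ln 2 < 1]. *)

Lemma ln_le_sub_1 (y : R) : 0 < y -> ln y <= y - 1.
Proof.
intros Hy.
pose proof (exp_ineq1_le (ln y)) as H.
rewrite exp_ln in H; lra.
Qed.

(** The difference of the two sides vanishes at [1] and has derivative [(1 - / x) ^ 2 / 2], a
    square. At [t = (x + 1) / x] this becomes the trapezoid bound. *)
Lemma ln_le_half_sub_inv (t : R) : 1 <= t -> ln t <= (t - / t) / 2.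
Proof.
intros Ht.
destruct (MVT_gen (fun x => (x - / x) / 2 - ln x) 1 t
  (fun x => (1 - / x) ^ 2 / 2)) as [c [_ E]].
- intros x Hx; rewrite Rmin_left in Hx by lra.
  auto_derive; [split; [lra | split; [lra | exact I]] | field; lra].
- intros x Hx; rewrite Rmin_left in Hx by lra.
  apply continuity_pt_filterlim.
  apply (ex_derive_continuous (fun y => (y - / y) / 2 - ln y)).
  auto_derive; split; [lra | split; [lra | exact I]].
- rewrite ln_1, Rinv_1 in E.
  pose proof (pow2_ge_0 (1 - / c)).
  assert (0 <= (1 - / c) ^ 2 / 2 * (t - 1)) by (apply Rmult_le_pos; lra).
  lra.
Qed.

Lemma ln_succ_ratio_lower (x : R) : 0 < x -> 1 / (x + 1) <= ln (x + 1) - ln x.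
Proof.
intros Hx.
(* The tangent bound is taken at the inverse ratio, so that a change of sign turns it into a lower
   bound. *)
assert (H : ln (x / (x + 1)) <= x / (x + 1) - 1)
  by (apply ln_le_sub_1, Rdiv_lt_0_compat; lra).
rewrite ln_div in H by lra.
replace (x / (x + 1) - 1) with (- (1 / (x + 1))) in H by (field; lra).
lra.
Qed.

Lemma ln_succ_ratio_upper (x : R) :
  0 < x -> ln (x + 1) - ln x <= (1 / x + 1 / (x + 1)) / 2.
Proof.
intros Hx.
rewrite <- ln_div by lra.
assert (Ht : 1 <= (x + 1) / x) by (apply Rle_div_r; lra).
apply Rle_trans with (1 := ln_le_half_sub_inv _ Ht).
right; field; lra.
Qed.

Lemma euler_gamma_seq_1 : euler_gamma_seq 1 = 1.
Proof.
unfold euler_gamma_seq; rewrite sum_n_n; simpl; rewrite ln_1; lra.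
Qed.

Lemma euler_gamma_seq_succ (n : nat) :
  euler_gamma_seq (S n)
  = euler_gamma_seq n + 1 / INR (S n) - (ln (INR (S n)) - ln (INR n)).
Proof.
unfold euler_gamma_seq; rewrite sum_n_Sm by lia.
unfold plus; cbn -[INR]; ring.
Qed.

Lemma euler_gamma_seq_decr (n : nat) :
  (1 <= n)%nat -> euler_gamma_seq (S n) <= euler_gamma_seq n.
Proof.
intros Hn.
rewrite euler_gamma_seq_succ, S_INR.
pose proof (ln_succ_ratio_lower (INR n) (lt_0_INR n Hn)); lra.
Qed.

(** The term [1 / INR n / 2] makes the induction close: by the trapezoid bound, each step loses at
    most [(1 / n - 1 / (n + 1)) / 2], which telescopes. At [n = 1] equality holds. *)
Lemma euler_gamma_seq_lower (n : nat) :
  (1 <= n)%nat -> 1 / 2 + 1 / INR n / 2 <= euler_gamma_seq n.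
Proof.
induction 1 as [|n Hn IH].
- rewrite euler_gamma_seq_1; simpl; lra.
- rewrite euler_gamma_seq_succ, S_INR.
  pose proof (ln_succ_ratio_upper (INR n) (lt_0_INR n Hn)); lra.
Qed.

Lemma euler_gamma_seq_ge_half (n : nat) :
  (1 <= n)%nat -> 1 / 2 <= euler_gamma_seq n.
Proof.
intros Hn.
pose proof (euler_gamma_seq_lower n Hn).
assert (0 < 1 / INR n) by (apply Rdiv_lt_0_compat; [lra | apply lt_0_INR, Hn]).
lra.
Qed.

(** Index 2 gives the strict bound on the limit, since the value at index 1 is exactly [1];
    [ln 2 > 1 / 2] suffices. *)
Lemma euler_gamma_seq_2_lt_1 : euler_gamma_seq 2 < 1.
Proof.
rewrite euler_gamma_seq_succ, euler_gamma_seq_1; simpl.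
rewrite ln_1; replace (1 + 1) with 2 by lra.
pose proof ln_lt_2; lra.
Qed.

Theorem mainTheorem2 :
  exists gamma : R,
    is_lim_seq euler_gamma_seq (Finite gamma) /\ 1 / 2 <= gamma < 1.
Proof.
(* The shift by one discards the junk term at index 0 and leaves the limit unchanged. *)
assert (Hdecr : forall n, euler_gamma_seq (S (S n)) <= euler_gamma_seq (S n))
  by (intros n; apply euler_gamma_seq_decr; lia).
assert (Hlow : forall n, 1 / 2 <= euler_gamma_seq (S n))
  by (intros n; apply euler_gamma_seq_ge_half; lia).
destruct (ex_finite_lim_seq_decr (fun n => euler_gamma_seq (S n)) (1 / 2)
  Hdecr Hlow) as [gamma Hlim].
exists gamma; split; [now apply is_lim_seq_incr_1 | split].
- exact (is_lim_seq_le _ _ (Finite (1 / 2)) (Finite gamma) Hlow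
    (is_lim_seq_const _) Hlim).
- apply Rle_lt_trans with (2 := euler_gamma_seq_2_lt_1).
  (* Index 1 of the shifted sequence is [euler_gamma_seq 2]. *)
  exact (is_lim_seq_decr_compare _ _ Hlim Hdecr 1%nat).
Qed.
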